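(* Let $\mathcal{G}\subset\mathbb{N}$ be a set of pairwise coprime positive integers, $\mathcal{H}=\{h_1,\dots,h_u\}$ a set of integers admissible with respect to $\mathcal{G}$ (i.e. $\nu_g(\mathcal{H})<g$ for all $g\in\mathcal{G}$), and \[ \mathcal{V}=\{n\in\mathbb{N}:\ n\not\equiv h_t \ (\mathrm{mod}\ g)\ \text{for all } t\le u \text{ and all } g\in\mathcal{G}\}. \] Suppose the family $(\mathcal{A}_n)_n$ satisfies Condition A with some parameter $\theta\in(0,1)$. Fix $\alpha\in(0,1)$ and let $(P_i)_{i\ge0}$ be the $\alpha$-random walk on $\mathbb{Z}_{\ge0}$: $P_0=0$, $P_i=P_{i-1}+W_i$ with $W_i$ independent Bernoulli variables, $\mathbb{P}(W_i=1)=\alpha$, $\mathbb{P}(W_i=0)=1-\alpha$. Let $\overline{S}_n(\mathcal{V})=\frac1n\sum_{i=1}^n\mathbf{1}[P_i\in\mathcal{V}]$. Then almost surely \[ \lim_{n\to\infty}\overline{S}_n(\mathcal{V})=c:=\prod_{g\in\mathcal{G}}\left(1-\frac{\nu_g(\mathcal{H})}{g}\right). \]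
   Context: $\mathbb{N}$ is the set of positive integers. $\nu_g(\mathcal{H})$ is the number of distinct residue classes modulo $g$ occupied by elements of $\mathcal{H}$. $\mathcal{A}$ is the set consisting of $1$ and all products of distinct elements of $\mathcal{G}$, and $\mathcal{A}_n=\{a\in\mathcal{A}: a\le n^{A_0}\}$ for a fixed large constant $A_0$. Condition A with parameter $\theta\in(0,1]$: a family $(\mathcal{A}_x)_{x>0}$ of sets of positive integers satisfies it if (i) there is a constant $A_0>0$ with $a\ll x^{A_0}$ for all $a\in\mathcal{A}_x$, and (ii) for every $\varepsilon>0$ and $A>0$, $|\mathcal{A}_x\cap[1,y]|\ll y^{\theta}(\log y)^{-A}$ for all $y\gg x^{\varepsilon}$ (for all sufficiently large $x$). *)

(* Defs.v *)
From HB Require Import structures.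
From mathcomp Require Import all_boot all_order all_algebra finmap.
From mathcomp Require Import all_classical all_reals all_analysis.

Set Implicit Arguments.
Unset Strict Implicit.
Unset Printing Implicit Defensive.

Import Order.TTheory GRing.Theory Num.Theory.
Import numFieldNormedType.Exports.

Local Open Scope classical_set_scope.
Local Open Scope ring_scope.

Definition pairwise_coprime (G : set nat) : Prop :=
  forall g g', G g -> G g' -> g <> g' -> coprime g g'.

Definition nu (g : nat) (H : {fset int}) : nat :=
  #|` [fset (h %% g%:Z)%Z | h in H]%fset|.

Definition admissible (G : set nat) (H : {fset int}) : Prop :=
  forall g, G g -> (nu g H < g)%N.

Definition sieved (G : set nat) (H : {fset int}) : set nat :=
  [set n | (0 < n)%N /\
    forall h g, h \in H -> G g -> ~ (n%:Z = h %[mod g%:Z])%Z].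

(** The empty subset of [G] contributes the element 1. *)
Definition distinct_products (G : set nat) : set nat :=
  [set (\prod_(g <- S : {fset nat}) g)%N | S in [set S | [set` S] `<=` G]].

Definition truncation (R : realType) (A : set nat) (A0 : R) (x : R) : set nat :=
  [set a | A a /\ a%:R <= x `^ A0].

(** [I] is the set of real indices over which the family ranges: all positive
    reals for a family [(F x)_{x > 0}], [positive_integers] for [(F n)_n].
    In (ii), [c] is the constant implicit in [y >> x^eps]; [K] and [x0] may
    depend on [eps], [A] and [c].  The set being counted is always finite, so
    [fset_set] does not fall back on its default value. *)
Definition condition_A (R : realType) (theta : R) (I : set R)
    (F : R -> set nat) : Prop :=
  (exists A0 K : R, 0 < A0 /\
    forall x a, I x -> F x a -> a%:R <= K * x `^ A0) /\
  (forall eps A c : R, 0 < eps -> 0 < A -> 0 < c ->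
    exists K x0 : R, forall x y : R, I x -> x0 <= x -> c * x `^ eps <= y ->
      #|` fset_set (F x `&` [set a | (1 <= a)%N /\ a%:R <= y])|%:R
        <= K * (y `^ theta * ln y `^ (- A))).

Definition positive_integers (R : realType) : set R :=
  [set n%:R | n in [set n | (0 < n)%N]].

Definition mutually_independent d d' (T : measurableType d)
    (T' : measurableType d') (R : realType) (P : probability T R)
    (X : nat -> {RV P >-> T'}) : Prop :=
  forall (J : {fset nat}) (B : nat -> set T'),
    (forall j, measurable (B j)) ->
    P (\bigcap_(j in [set` J]) (X j @^-1` B j)) =
      (\prod_(j <- J) P (X j @^-1` B j))%E.

(** [W i] is the step leading from time [i] to time [i.+1]. *)
Fixpoint walk (T : Type) (W : nat -> T -> nat) (i : nat) (w : T) : nat :=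
  if i is j.+1 then (walk W j w + W j w)%N else 0%N.

Definition is_bernoulli d (T : measurableType d) (R : realType)
    (P : probability T R) (alpha : R) (X : {RV P >-> nat}) : Prop :=
  P (X @^-1` [set 1%N]) = alpha%:E /\ P (X @^-1` [set 0%N]) = (1 - alpha)%:E.

Definition walk_average (R : realType) (T : Type) (W : nat -> T -> nat)
    (V : set nat) (n : nat) (w : T) : R :=
  n%:R^-1 * \sum_(1 <= i < n.+1) \1_V (walk W i w).

(** For admissible [H] every factor lies in ]0, 1], so the partial products
    are nonincreasing and the limit exists and does not depend on the order. *)
Definition sieve_density (R : realType) (G : set nat) (H : {fset int}) : R :=
  limn (fun N => \prod_(1 <= g < N.+1 | g \in G)
                   (1 - (nu g H)%:R / g%:R) : R).

(* Main.v *)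
(** Only the convergence of [\sum_(g in G) 1/g] is used from Condition A: the
    elements of [G] belong to its set of distinct products, so [G] has
    [O(Y^theta)] elements up to [Y], and a dyadic decomposition applies.
    Given this, the set [V] has natural density [c]: sieving by the moduli up
    to [z] leaves a periodic set whose density is the partial product, by the
    Chinese remainder theorem, and the remaining moduli remove a proportion
    at most [O(\sum_(g > z) 1/g)].

    To pass from the natural density to the walk, put [f = 1_V] and split
    [alpha * \sum_(i < n) f(P_i) = \sum_(i < n) f(P_i) W_i - M_n] with
    [M_n = \sum_(i < n) f(P_i) (W_i - alpha)]. Each site below the current
    position is left exactly once, so the first sum counts [V] below [P_n].
    The increments of [M_n] are orthogonal, hence [E M_n^2 <= n]; Chebyshev's
    inequality and Borel-Cantelli along [n = m^4], plus bounded increments,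
    give [M_n / n --> 0] almost surely. With [f = 1] the same bound yields
    [P_n / n --> alpha]. *)

Require Import Defs.
From mathcomp Require Import all_boot all_order all_algebra finmap.
From mathcomp Require Import all_classical all_reals all_analysis.
From mathcomp Require Import lra zify.

Set Implicit Arguments.
Unset Strict Implicit.
Unset Printing Implicit Defensive.

Import Order.TTheory GRing.Theory Num.Theory.
Import numFieldNormedType.Exports.

Local Open Scope classical_set_scope.
Local Open Scope ring_scope.

(** * Finite Bernoulli paths and the second moment of the centered sum *)

(** Enumerating the outcomes of [n] steps turns expectations into finite sums, so the second moment
    is computed without integrals. *)
Fixpoint bool_seqs (n : nat) : seq (seq bool) :=
  if n is m.+1 then
    map (cons true) (bool_seqs m) ++ map (cons false) (bool_seqs m)
  else [:: [::]].

Lemma mem_bool_seqs (s : seq bool) : s \in bool_seqs (size s).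
Proof.
elim: s => [|b s ih] //=; rewrite mem_cat; apply/orP.
by case: b; [left|right]; apply/map_f.
Qed.

Lemma sum_bool_seqsS (R : realType) (n : nat) (F : seq bool -> R) :
  \sum_(s <- bool_seqs n.+1) F s =
  \sum_(s <- bool_seqs n) (F (true :: s) + F (false :: s)).
Proof. by rewrite /= big_cat !big_map big_split. Qed.

Definition path_weight (R : realType) (alpha : R) (s : seq bool) : R :=
  \prod_(b <- s) (if b then alpha else 1 - alpha).

(* Lists are read with the most recent step first. *)
Fixpoint centered_sum (R : realType) (alpha : R) (f : nat -> R)
    (s : seq bool) : R :=
  if s is b :: s' then
    centered_sum alpha f s' + f (count id s') * (b%:R - alpha)
  else 0.

Lemma path_weight_ge0 (R : realType) (alpha : R) (s : seq bool) :
  0 <= alpha <= 1 -> 0 <= path_weight alpha s.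
Proof.
move=> /andP[a0 a1]; apply: prodr_ge0 => -[] _ //.
by rewrite subr_ge0.
Qed.

Lemma path_weight_sum (R : realType) (alpha : R) (n : nat) :
  \sum_(s <- bool_seqs n) path_weight alpha s = 1.
Proof.
elim: n => [|n ih]; first by rewrite big_seq1 /path_weight big_nil.
rewrite sum_bool_seqsS -ih; apply: eq_bigr => s _.
by rewrite /path_weight !big_cons -mulrDl addrC subrK mul1r.
Qed.

(* The cross term vanishes because the new step has mean [alpha] whatever the
   past is. *)
Lemma second_moment (R : realType) (alpha : R) (f : nat -> R) (n : nat) :
  0 <= alpha <= 1 -> (forall k, `|f k| <= 1) ->
  \sum_(s <- bool_seqs n) path_weight alpha s * centered_sum alpha f s ^+ 2
    <= n%:R.
Proof.
move=> a01 f1; elim: n => [|n ih].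
  by rewrite big_seq1 /= expr0n mulr0.
rewrite sum_bool_seqsS -natr1 -[X in _ <= _ + X](path_weight_sum alpha n).
apply: (@le_trans _ _ (\sum_(s <- bool_seqs n)
   (path_weight alpha s * centered_sum alpha f s ^+ 2 + path_weight alpha s)));
  last by rewrite big_split/= lerD2r.
apply: ler_sum => s _ /=.
have w0 := path_weight_ge0 s a01.
rewrite /path_weight !big_cons -/(path_weight alpha s).
set w := path_weight alpha s in w0 *; set M := centered_sum _ _ _.
set x := f _.
have x1 : x ^+ 2 <= 1 by rewrite -real_normK ?num_real// expr_le1//; exact: f1.
(* The terms linear in [x] cancel; [alpha * (1 - alpha)] is the variance of one step. *)
have -> : alpha * w * (M + x * (true%:R - alpha)) ^+ 2 +
  (1 - alpha) * w * (M + x * (false%:R - alpha)) ^+ 2 =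
  w * M ^+ 2 + w * (x ^+ 2 * (alpha * (1 - alpha))) by rewrite /=; lra.
rewrite lerD2l ler_piMr//; move: a01 => /andP[a0 a1].
rewrite mulr_ile1 ?sqr_ge0// ?mulr_ge0 ?mulr_ile1 ?subr_ge0//.
by rewrite lerBlDr lerDl.
Qed.

Lemma chebyshev_paths (R : realType) (alpha : R) (f : nat -> R) (n : nat)
    (t : R) :
  0 <= alpha <= 1 -> (forall k, `|f k| <= 1) -> 0 < t ->
  \sum_(s <- bool_seqs n | t <= `|centered_sum alpha f s|) path_weight alpha s
    <= n%:R / t ^+ 2.
Proof.
move=> a01 f1 t0; rewrite ler_pdivlMr ?exprn_gt0//.
apply: le_trans (second_moment n a01 f1).
rewrite mulr_suml big_mkcond/=; apply: ler_sum => s _.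
have w0 := path_weight_ge0 s a01.
case: ifPn => [tM|_]; last by rewrite mulr_ge0// sqr_ge0.
apply: ler_wpM2l => //.
rewrite -[leRHS]real_normK ?num_real//.
by rewrite ler_pXn2r// nnegrE ltW.
Qed.

(** * Transfer of path estimates to the probability space *)

(** Any step value other than 1 is recorded as [false], so the list is faithful only where all steps
    are at most 1. *)
Fixpoint history (T : Type) (W : nat -> T -> nat) (n : nat) (w : T) :
    seq bool :=
  if n is m.+1 then (W m w == 1)%N :: history W m w else [::].

Lemma size_history (T : Type) (W : nat -> T -> nat) (n : nat) (w : T) :
  size (history W n w) = n.
Proof. by elim: n => //= n ->. Qed.

Lemma count_history (T : Type) (W : nat -> T -> nat) (n : nat) (w : T) :
  (forall i, (W i w <= 1)%N) -> count id (history W n w) = walk W n w.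
Proof.
move=> W1; elim: n => //= n ->; rewrite addnC; congr addn.
by have := W1 n; case: (W n w) => [|[]].
Qed.

Lemma centered_sum_history (R : realType) (alpha : R) (f : nat -> R)
    (T : Type) (W : nat -> T -> nat) (n : nat) (w : T) :
  (forall i, (W i w <= 1)%N) ->
  centered_sum alpha f (history W n w) =
  \sum_(0 <= i < n) f (walk W i w) * ((W i w)%:R - alpha).
Proof.
move=> W1; elim: n => [|n ih]; first by rewrite big_nil.
rewrite big_nat_recr//= ih count_history//; congr (_ + _ * (_%:R - _)).
by have := W1 n; case: (W n w) => [|[]].
Qed.

(** [rev] restores chronological order, and the intersection runs over a finite set of indices so
    that [mutually_independent] applies as it stands. *)
Definition cylinder (T : Type) (W : nat -> T -> nat) (s : seq bool) : set T :=
  \bigcap_(j in [set` [fset j in iota 0 (size s)]%fset])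
    (W j @^-1` [set (nth false (rev s) j : nat)]).

Lemma history_cylinder (T : Type) (W : nat -> T -> nat) (n : nat) (w : T) :
  (forall i, (W i w <= 1)%N) -> cylinder W (history W n w) w.
Proof.
move=> W1 j /=; rewrite !inE mem_iota add0n size_history => /= jn.
elim: n jn => // n ih; rewrite ltnS leq_eqVlt /= rev_cons nth_rcons size_rev.
rewrite size_history => /orP[/eqP ->|jn]; last by rewrite jn; exact: ih.
by rewrite ltnn eqxx; have := W1 n; case: (W n w) => [|[]].
Qed.

Lemma measurable_cylinder d (T : measurableType d) (R : realType)
    (P : probability T R) (W : nat -> {RV P >-> nat}) (s : seq bool) :
  measurable (cylinder W s).
Proof.
apply: fin_bigcap_measurable => [|j _]; first exact: finite_fset.
by rewrite -[X in measurable X]setTI; exact: measurable_funP.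
Qed.

Lemma cylinder_probability d (T : measurableType d) (R : realType)
    (alpha : R) (P : probability T R) (W : nat -> {RV P >-> nat})
    (s : seq bool) :
  mutually_independent W -> (forall i, is_bernoulli alpha (W i)) ->
  P (cylinder W s) = (path_weight alpha s)%:E.
Proof.
move=> W_indep W_bern.
rewrite /cylinder (W_indep _ (fun j => [set (nth false (rev s) j : nat)]))//.
rewrite /path_weight -[in RHS](revK s) (perm_big _ (permEl (perm_rev _))).
rewrite -(size_rev s); move: (rev s) => {}s.
rewrite (perm_big (iota 0 (size s))) /=; last first.
  by apply: uniq_perm => [||j]; rewrite ?fset_uniq ?iota_uniq// !inE.
rewrite (_ : iota 0 _ = index_iota 0 (size s)) ?[LHS]big_mkord; last first.
  by rewrite /index_iota subn0.
rewrite (big_nth false) -prodEFin big_mkord.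
apply: eq_bigr => j _; case: (W_bern j) => W1 W0.
by case: (nth false s j); rewrite ?W1 ?W0.
Qed.

Lemma probability_bigsetU_le d (T : measurableType d) (R : realType)
    (P : probability T R) (I : Type) (r : seq I) (Q : pred I)
    (A : I -> set T) :
  (forall i, measurable (A i)) ->
  (P (\big[setU/set0]_(i <- r | Q i) A i) <= \sum_(i <- r | Q i) P (A i))%E.
Proof.
move=> mA; elim: r => [|i r ih]; first by rewrite !big_nil measure0.
rewrite !big_cons; case: ifP => // _.
apply: (le_trans (measureU2 _ _ _)) => //.
  exact: bigsetU_measurable.
exact: leeD2l.
Qed.

(** As a finite union of cylinders the event is measurable at once, and subadditivity bounds its
    probability by the sum in [chebyshev_paths]. *)
Definition deviation_event d (T : measurableType d) (R : realType)
    (P : probability T R) (W : nat -> {RV P >-> nat}) (alpha : R)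
    (f : nat -> R) (n : nat) (t : R) : set T :=
  \big[setU/set0]_(s <- bool_seqs n | t <= `|centered_sum alpha f s|)
    cylinder W s.

Lemma measurable_deviation_event d (T : measurableType d) (R : realType)
    (P : probability T R) (W : nat -> {RV P >-> nat}) (alpha : R)
    (f : nat -> R) (n : nat) (t : R) :
  measurable (deviation_event W alpha f n t).
Proof.
by apply: bigsetU_measurable => s _; exact: measurable_cylinder.
Qed.

Lemma deviation_probability d (T : measurableType d) (R : realType)
    (P : probability T R) (W : nat -> {RV P >-> nat}) (alpha : R)
    (f : nat -> R) (n : nat) (t : R) :
  mutually_independent W -> (forall i, is_bernoulli alpha (W i)) ->
  0 <= alpha <= 1 -> (forall k, `|f k| <= 1) -> 0 < t ->
  (P (deviation_event W alpha f n t) <= (n%:R / t ^+ 2)%:E)%E.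
Proof.
move=> W_indep W_bern a01 f1 t0.
apply: (le_trans (probability_bigsetU_le P _ _ (measurable_cylinder W))).
rewrite (eq_bigr (fun s => (path_weight alpha s)%:E)); last first.
  by move=> s _; exact: cylinder_probability.
by rewrite sumEFin lee_fin; exact: chebyshev_paths.
Qed.

Lemma history_deviation d (T : measurableType d) (R : realType)
    (P : probability T R) (W : nat -> {RV P >-> nat}) (alpha : R)
    (f : nat -> R) (n : nat) (t : R) (w : T) :
  (forall i, (W i w <= 1)%N) ->
  t <= `|centered_sum alpha f (history W n w)| ->
  deviation_event W alpha f n t w.
Proof.
move=> W1 tM; rewrite /deviation_event.
rewrite -bigcup_seq_cond; exists (history W n w) => /=; last first.
  exact: history_cylinder.
by rewrite tM -[X in bool_seqs X](size_history W n w) mem_bool_seqs.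
Qed.

(** * Almost sure bounds along fourth powers *)

Lemma sum_inv_sqr_le2 (R : realType) (n : nat) :
  \sum_(0 <= i < n) (i.+1%:R ^+ 2)^-1 <= 2 :> R.
Proof.
(* The sharper bound goes through induction, since [1 / x ^ 2 <= 2 / x - 2 / (x + 1)] for
   [x >= 1]. *)
suff : \sum_(0 <= i < n) (i.+1%:R ^+ 2)^-1 <= 2 - 2 / n.+1%:R :> R.
  by move=> /le_trans; apply; rewrite gerBl divr_ge0.
elim: n => [|n ih]; first by rewrite big_nil divr1 subrr.
rewrite big_nat_recr//=; apply: (le_trans (lerD ih (lexx _))).
rewrite -[n.+2%:R]natr1 -addrA lerD2l -lerBrDl opprK.
set x : R := n.+1%:R.
have x1 : 1 <= x by rewrite ler1n.
have x0 : x != 0 by rewrite gt_eqF// (lt_le_trans _ x1).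
have y0 : x + 1 != 0 by rewrite gt_eqF// addr_gt0// (lt_le_trans _ x1).
have -> : - (2 / (x + 1)) + 2 / x = 2 / (x * (x + 1)).
  rewrite invfM mulrA addrC -mulrN -mulrDr -mulrA; congr (_ * _).
  apply: (mulfI x0); rewrite mulrDr mulfV// mulrA mulfV// mul1r mulrN.
  by apply: (mulIf y0); rewrite mulrBl mul1r mulfVK// addrC addKr mulVf.
rewrite ler_pdivlMr; last by rewrite mulr_gt0//; lra.
rewrite mulrC ler_pdivrMr; last by rewrite exprn_gt0//; lra.
nra.
Qed.

(** [is_bernoulli] prescribes two masses, not the range of the variable; as they add up to 1, other
    values occur only on a null set. *)
Lemma steps_le1_ae d (T : measurableType d) (R : realType)
    (P : probability T R) (W : nat -> {RV P >-> nat}) (alpha : R) :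
  (forall i, is_bernoulli alpha (W i)) ->
  {ae P, forall w, forall i, (W i w <= 1)%N}.
Proof.
move=> W_bern; apply: ae_foralln => i; case: (W_bern i) => W1 W0.
have m k : measurable (W i @^-1` [set k]).
  by rewrite -[X in measurable X]setTI; exact: measurable_funP.
exists (~` (W i @^-1` [set 1%N] `|` W i @^-1` [set 0%N])); split.
- exact/measurableC/measurableU.
- rewrite [LHS]probability_setC; last exact: measurableU.
  rewrite measureU//; last first.
    by apply/seteqP; split => w //= [] ->.
  by rewrite [X in (_ - (X + _))%E]W1 [X in (_ - (_ + X))%E]W0
    -EFinD (addrC alpha) subrK subrr.
- move=> w /= Ww; apply: contra_not Ww => -[] -> //.
Qed.

(** At time [n ^ 4] with threshold [n ^ 3], Chebyshev gives [n ^ 4 / n ^ 6 = 1 / n ^ 2], which is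
    summable, while the threshold stays of smaller order than the time. Borel-Cantelli then
    applies. *)
Lemma centered_sum_quartic_ae d (T : measurableType d) (R : realType)
    (P : probability T R) (W : nat -> {RV P >-> nat}) (alpha : R)
    (f : nat -> R) :
  mutually_independent W -> (forall i, is_bernoulli alpha (W i)) ->
  0 <= alpha <= 1 -> (forall k, `|f k| <= 1) ->
  {ae P, forall w, exists N, forall n, (N <= n)%N ->
    `|centered_sum alpha f (history W (n.+1 ^ 4)%N w)| < n.+1%:R ^+ 3}.
Proof.
move=> W_indep W_bern a01 f1.
pose F n := deviation_event W alpha f (n.+1 ^ 4)%N (n.+1%:R ^+ 3).
have mF n : measurable (F n) by exact: measurable_deviation_event.
have F0 : P (lim_sup_set F) = 0.
  apply: lim_sup_set_cvg0 => //.
  apply: (@le_lt_trans _ _ 2%:E); last exact: ltry.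
  apply: lime_le; first by apply: is_cvg_nneseries => *; exact: measure_ge0.
  apply: nearW => n.
  apply: (@le_trans _ _ (\sum_(0 <= i < n) ((i.+1%:R ^+ 2)^-1)%:E)%E).
    apply: lee_sum => i _.
    apply: (le_trans (deviation_probability _ W_indep W_bern a01 f1 _)).
      by rewrite exprn_gt0.
    rewrite lee_fin natrX -exprM (_ : 3 * 2 = 4 + 2)%N// exprD invfM mulrA.
    by rewrite mulfV ?mul1r// expf_neq0// pnatr_eq0.
  by rewrite sumEFin lee_fin sum_inv_sqr_le2.
have [B [mB B0 badB]] := steps_le1_ae W_bern.
(* [B] absorbs the points with a step above 1, whose history need not describe the walk. *)
exists (lim_sup_set F `|` B); split.
- apply: measurableU => //; apply: bigcap_measurable => // k _.
  by apply: bigcup_measurable.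
- apply/eqP; rewrite eq_le measure_ge0 andbT.
  have mL : measurable (lim_sup_set F).
    by apply: bigcap_measurable => // k _; apply: bigcup_measurable.
  apply: (le_trans (measureU2 _ mL mB)).
  by rewrite [X in (X + _)%E]F0 [X in (_ + X)%E]B0 adde0.
- move=> w /= nw; have [Bw|nB] := pselect (B w); [by right|left].
  have W1 : forall i, (W i w <= 1)%N by apply: contrapT => ?; exact/nB/badB.
  move=> N _; apply: contrapT => nN; apply: nw; exists N => n Nn.
  rewrite ltNge; apply/negP => dev; apply: nN; exists n => //.
  exact: history_deviation.
Qed.

(** * From fourth powers to all times *)

Lemma fourth_root_bracket (m : nat) : (0 < m)%N ->
  exists n, (n.+1 ^ 4 <= m < n.+2 ^ 4)%N.
Proof.
elim: m => // -[_ _|m /(_ isT)[n /andP[h1 h2]] _]; first by exists 0%N.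
have [h|h] := leqP (n.+2 ^ 4) m.+2.
  by exists n.+1; rewrite h /= (leq_ltn_trans h2)// ltn_exp2r.
by exists n; rewrite h (leq_trans h1).
Qed.

(** Write [x = n.+1] and let [m] lie between [x ^ 4] and [(x + 1) ^ 4]. The gap is at most
    [15 * x ^ 3], so increments bounded by 1 give [|M m| <= 16 * x ^ 3], which is small compared
    with [m >= x ^ 4]. *)
Lemma cvg0_of_quartic (R : realType) (M : nat -> R) :
  (forall n, `|M n.+1 - M n| <= 1) ->
  (exists N, forall n, (N <= n)%N -> `|M (n.+1 ^ 4)%N| < n.+1%:R ^+ 3) ->
  (fun n => n%:R^-1 * M n) @ \oo --> (0 : R).
Proof.
move=> M1 [N MN].
have lip m k : `|M (m + k)%N - M m| <= k%:R.
  elim: k => [|k ih]; first by rewrite addn0 subrr normr0.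
  rewrite addnS -nat1r -(subrK (M (m + k)%N) (M (m + k).+1)) -addrA.
  exact: (le_trans (ler_normD _ _) (lerD (M1 _) ih)).
apply/cvgr0Pnorm_le => e e0; near=> m.
have m0 : (0 < m)%N by near: m; exact: nbhs_infty_gt.
have [n /andP[nm mn]] := fourth_root_bracket m0.
(* Chosen so that [K <= n] yields both [N <= n] and [16 <= e * n.+1]. *)
pose K := maxn N (Num.trunc (16 / e)).+1.
have Km : (K.+2 ^ 4 <= m)%N by near: m; exact: nbhs_infty_ge.
have Kn : (K <= n)%N.
  by have := leq_ltn_trans Km mn; rewrite ltn_exp2r// !ltnS => /ltnW.
have := MN n (leq_trans (leq_maxl _ _) Kn).
have := lip (n.+1 ^ 4)%N (m - n.+1 ^ 4)%N; rewrite subnKC// => l1 l2.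
have l3 : (m - n.+1 ^ 4 <= 15 * n.+1 ^ 3)%N.
  rewrite leq_subLR (leq_trans (ltnW mn))//.
  by rewrite -[n.+2]addn1 !expnS !expn0; nia.
have l4 : `|M m| <= 16 * n.+1%:R ^+ 3.
  rewrite -(subrK (M (n.+1 ^ 4)%N) (M m)).
  apply: (le_trans (ler_normD _ _)).
  have : (m - n.+1 ^ 4)%:R <= (15 * n.+1 ^ 3)%:R :> R by rewrite ler_nat.
  by rewrite natrM natrX; lra.
have n4 : n.+1%:R ^+ 4 <= m%:R :> R by rewrite -natrX ler_nat.
have en : 16 <= e * n.+1%:R.
  rewrite mulrC -ler_pdivrMr//; apply: (le_trans (ltW (truncnS_gt _))).
  by rewrite ler_nat (leq_trans _ (leqW Kn))// leq_maxr.
rewrite normrM ger0_norm ?invr_ge0// mulrC ler_pdivrMr ?ltr0n//.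
apply: (le_trans l4); apply: (@le_trans _ _ (e * n.+1%:R ^+ 4)); last first.
  by rewrite ler_pM2l.
by rewrite [_ ^+ 4]exprS mulrA ler_wpM2r// exprn_ge0.
Unshelve. all: by end_near.
Qed.

(** * Averages along a single path of the walk *)

(* The walk leaves each site below its current position exactly once. *)
Lemma sum_visited (R : realType) (T : Type) (f : nat -> R)
    (W : nat -> T -> nat) (n : nat) (w : T) :
  (forall i, (W i w <= 1)%N) ->
  \sum_(0 <= i < n) f (walk W i w) * (W i w)%:R =
  \sum_(0 <= k < walk W n w) f k.
Proof.
move=> W1; elim: n => [|n ih]; first by rewrite !big_nil.
rewrite big_nat_recr//= ih; have := W1 n.
case: (W n w) => [_|[|]//]; first by rewrite mulr0 addr0 addn0.
by rewrite mulr1 addn1 big_nat_recr.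
Qed.

(** Purely deterministic: the path is fixed, and the two almost sure limits enter as hypotheses. *)
Lemma cvg_walk_average (R : realType) (alpha c : R) (f : nat -> R) (T : Type)
    (W : nat -> T -> nat) (w : T) :
  0 < alpha -> (forall k, `|f k| <= 1) ->
  (forall i, (W i w <= 1)%N) ->
  (fun n => n%:R^-1 * \sum_(0 <= k < n) f k) @ \oo --> c ->
  (fun n => n%:R^-1 * \sum_(0 <= i < n)
     ((W i w)%:R - alpha)) @ \oo --> (0 : R) ->
  (fun n => n%:R^-1 * \sum_(0 <= i < n)
     f (walk W i w) * ((W i w)%:R - alpha)) @ \oo --> (0 : R) ->
  (fun n => n%:R^-1 * \sum_(1 <= i < n.+1) f (walk W i w)) @ \oo --> c.
Proof.
move=> a0 f1 W1 fc L1 Lf.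
have a_neq0 : alpha != 0 by rewrite gt_eqF.
have sumW n : \sum_(0 <= i < n) (W i w)%:R = (walk W n w)%:R :> R.
  elim: n => [|n ih]; first by rewrite big_nil.
  by rewrite big_nat_recr//= ih natrD.
have Pa : (fun n => n%:R^-1 * (walk W n w)%:R) @ \oo --> alpha.
  have := cvgD L1 (cvg_cst alpha); rewrite add0r => h.
  apply: cvg_trans; last exact: h.
  apply: near_eq_cvg; near=> n; rewrite ?fctE /=.
  have n0 : (n%:R : R) != 0.
    by rewrite pnatr_eq0 -lt0n; near: n; exact: nbhs_infty_gt.
  rewrite sumrB sumW big_const_nat subn0 iter_addr_0 mulrBr.
  by rewrite -[alpha *+ n]mulr_natl mulKf// subrK.
(* Divergence of the walk allows the averages of [f] to be evaluated at its position. *)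
have Poo : walk W n w @[n --> \oo] --> \oo.
  apply/cvgnyPge => A; near=> n.
  have n0 : 0 < n%:R :> R by rewrite ltr0n; near: n; exact: nbhs_infty_gt.
  have h : alpha / 2 <= n%:R^-1 * (walk W n w)%:R.
    by near: n; apply: (cvgr_ge alpha) => //; lra.
  have h2 : A%:R / (alpha / 2) <= n%:R.
    near: n; exists (Num.trunc (A%:R / (alpha / 2))).+1 => //= m /= ?.
    by apply: (le_trans (ltW (truncnS_gt _))); rewrite ler_nat.
  have {}h : alpha / 2 * n%:R <= (walk W n w)%:R.
    by rewrite -ler_pdivlMr// [leRHS]mulrC.
  rewrite -(ler_nat R); apply: le_trans h.
  by rewrite mulrC -ler_pdivrMr// divr_gt0.
(* Factor as the speed of the walk times the average of [f] below its position, which is nonzero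
   eventually. *)
have fP : (fun n => n%:R^-1 * \sum_(0 <= k < walk W n w) f k) @ \oo
    --> alpha * c.
  have h := cvgM Pa (cvg_comp _ _ Poo fc); apply: cvg_trans; last exact: h.
  apply: near_eq_cvg; near=> n; rewrite ?fctE /=.
  rewrite -mulrA mulVKf//.
  rewrite pnatr_eq0 -lt0n; near: n.
  by move/cvgnyPgt : Poo; exact.
have main : (fun n => n%:R^-1 * \sum_(0 <= i < n) f (walk W i w)) @ \oo --> c.
  have := cvgM (cvgB fP Lf) (cvg_cst alpha^-1).
  rewrite subr0 mulrAC mulfV// mul1r => h; apply: cvg_trans; last exact: h.
  apply: near_eq_cvg; near=> n; rewrite ?fctE /=.
  rewrite -mulrBr -mulrA -sum_visited// -sumrB; congr (_ * _).
  rewrite mulr_suml; apply: eq_bigr => i _.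
  by rewrite -mulrBr opprB addrCA subrr addr0 mulfK.
(* The decomposition covers times [0] to [n - 1], the average times [1] to [n]; the shift costs
   these two boundary terms. *)
have bd : (fun n => n%:R^-1 * (f (walk W n w) - f (walk W 0 w))) @ \oo
    --> (0 : R).
  apply/cvgr0Pnorm_le => e e0; near=> n.
  have n0 : 0 < n%:R :> R by rewrite ltr0n; near: n; exact: nbhs_infty_gt.
  rewrite normrM ger0_norm ?invr_ge0 ?ler0n// mulrC ler_pdivrMr//.
  have := ler_normB (f (walk W n w)) (f (walk W 0 w)).
  move=> /le_trans; apply; apply: (le_trans (lerD (f1 _) (f1 _))).
  rewrite mulrC -ler_pdivrMr//; near: n.
  exists (Num.trunc ((1 + 1) / e)).+1 => //= m /= ?.
  by apply: (le_trans (ltW (truncnS_gt _))); rewrite ler_nat.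
have := cvgD main bd; rewrite addr0 => h; apply: cvg_trans; last exact: h.
apply: near_eq_cvg; near=> n; rewrite ?fctE /= -mulrDr; congr (_ * _).
rewrite addrA -(big_nat_recr n 0%N (fun i => f (walk W i w)))//=.
by rewrite big_nat_recl//= addrAC subrr add0r [RHS]big_add1.
Unshelve. all: by end_near.
Qed.

(** * Counting in periodic sets *)

(** By the Chinese remainder theorem the pair of residues is injective on [[0, Q * g)], hence
    bijective by cardinality, and the count factors. *)
Lemma sum_coprime_periods (Q g : nat) (A B : pred nat) :
  (0 < Q)%N -> (0 < g)%N -> coprime Q g ->
  (forall n, A n = A (n %% Q)%N) -> (forall n, B n = B (n %% g)%N) ->
  (\sum_(0 <= n < Q * g) (A n && B n) =
   (\sum_(0 <= n < Q) A n) * (\sum_(0 <= n < g) B n))%N.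
Proof.
move=> Q0 g0 Qg AQ Bg; rewrite !big_mkord big_distrlr /= pair_bigA /=.
pose h (i : 'I_(Q * g)) : 'I_Q * 'I_g :=
  (Ordinal (ltn_pmod i Q0), Ordinal (ltn_pmod i g0)).
have h_inj : injective h.
  move=> i j [/eqP ij1 /eqP ij2]; apply/val_inj/eqP => /=.
  have : i == j %[mod Q * g] by rewrite chinese_remainder// ij1.
  by rewrite !modn_small.
have h_bij : bijective h.
  by apply: inj_card_bij => //; rewrite card_prod !card_ord.
rewrite [RHS](reindex h) /=; last exact: onW_bij.
by apply: eq_bigr => i _; rewrite -AQ -Bg mulnb.
Qed.

Lemma sum_period_shift (Q N : nat) (A : pred nat) :
  (forall n, A (n + Q)%N = A n) ->
  (\sum_(0 <= n < Q + N) A n =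
   \sum_(0 <= n < Q) A n + \sum_(0 <= n < N) A n)%N.
Proof.
move=> AQ; rewrite (big_cat_nat (n := Q)) ?leq_addr//=; congr addn.
rewrite -{1}[Q]add0n big_addn addKn; apply: eq_bigr => n _.
by rewrite AQ.
Qed.

(** Full periods contribute exactly [rho * Q] and can be stripped off; for the remaining [N < Q]
    both quantities lie in [[0, N]]. *)
Lemma periodic_discrepancy (R : realType) (Q : nat) (A : pred nat) (rho : R) :
  (0 < Q)%N -> (forall n, A (n + Q)%N = A n) -> 0 <= rho <= 1 ->
  (\sum_(0 <= n < Q) A n)%N%:R = rho * Q%:R ->
  forall N, `|(\sum_(0 <= n < N) A n)%N%:R - rho * N%:R| <= Q%:R.
Proof.
move=> Q0 AQ /andP[rho0 rho1] sumQ N.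
elim/ltn_ind: N => N ih; have [QN|NQ] := leqP Q N.
  have /ih : (N - Q < N)%N by rewrite ltn_subrL Q0 (leq_trans Q0).
  move: (subnKC QN); move: (N - Q)%N => M <-.
  by rewrite sum_period_shift// !natrD mulrDr sumQ opprD addrACA subrr add0r.
have s_le : (\sum_(0 <= n < N) A n)%N%:R <= N%:R :> R.
  rewrite ler_nat -[leqRHS]muln1 -[X in (_ <= X * _)%N]subn0 -sum_nat_const_nat.
  by apply: leq_sum => n _; exact: leq_b1.
have N_le : N%:R <= Q%:R :> R by rewrite ler_nat ltnW.
have rN : 0 <= rho * N%:R <= N%:R.
  by rewrite mulr_ge0//= ler_piMl.
have s0 : 0 <= (\sum_(0 <= n < N) A n)%N%:R :> R by [].
rewrite ler_norml; lra.
Qed.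

(** Each full period holds at most one element, and so does the incomplete one. *)
Lemma periodic_count_le (R : realType) (Q : nat) (A : pred nat) (N : nat) :
  (0 < Q)%N -> (forall n, A (n + Q)%N = A n) ->
  (\sum_(0 <= n < Q) A n <= 1)%N ->
  (\sum_(0 <= n < N) A n)%N%:R <= N%:R / Q%:R + 1 :> R.
Proof.
move=> Q0 AQ sumQ; have Q0R : 0 < Q%:R :> R by rewrite ltr0n.
elim/ltn_ind: N => N ih; have [QN|NQ] := leqP Q N.
  have /ih : (N - Q < N)%N by rewrite ltn_subrL Q0 (leq_trans Q0).
  move: (subnKC QN); move: (N - Q)%N => M <- ihM.
  rewrite sum_period_shift// !natrD mulrDl mulfV ?gt_eqF// -addrA.
  by apply: lerD => //; rewrite -[1]/(1%:R) ler_nat.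
apply: (@le_trans _ _ 1); last by rewrite lerDr divr_ge0.
rewrite -[1]/(1%:R) ler_nat; apply: leq_trans sumQ.
by rewrite [leqRHS](big_cat_nat (n := N)) ?leq_addr// ltnW.
Qed.

Lemma sum_pred1_le1 (r N : nat) : (\sum_(0 <= n < N) (n == r) <= 1)%N.
Proof.
have [rN|Nr] := ltnP r N.
  rewrite (bigD1_seq r) ?mem_index_iota ?iota_uniq//= eqxx big1 => [//|i].
  by move=> /negbTE ->.
rewrite big_nat big1// => i iN; rewrite (_ : (i == r) = false)//.
by apply/negbTE; rewrite neq_ltn (leq_trans _ Nr).
Qed.

(** * Sieving by the moduli up to [z] *)

Definition residues (H : {fset int}) (g : nat) : {fset int} :=
  [fset (h %% g%:Z)%Z | h in H]%fset.

Definition avoids (H : {fset int}) (g : nat) : pred nat :=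
  fun n => (n%:Z %% g%:Z)%Z \notin residues H g.

Lemma avoidsP (H : {fset int}) (g n : nat) :
  reflect (forall h, h \in H -> ~ (n%:Z = h %[mod g%:Z])%Z) (avoids H g n).
Proof.
apply: (iffP idP) => [av h hH E|av].
  by move/negP : av; apply; rewrite E; apply/imfsetP; exists h.
by apply/negP => /imfsetP[h /= hH E]; exact: (av h hH).
Qed.

Lemma sum_avoids (H : {fset int}) (g : nat) : (0 < g)%N ->
  (\sum_(0 <= n < g) avoids H g n = g - nu g H)%N.
Proof.
move=> g0.
have small n : (n < g)%N -> (n%:Z %% g%:Z)%Z = n.
  by move=> ng; rewrite modz_nat modn_small.
have total : (\sum_(0 <= n < g) avoids H g n +
    \sum_(0 <= n < g) (n%:Z \in residues H g) = g)%N.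
  rewrite -big_split /= -[RHS]subn0 -[RHS]muln1 -sum_nat_const_nat.
  rewrite big_nat [RHS]big_nat; apply: eq_bigr => n /andP[_ ng].
  by rewrite /avoids small//; case: (_ \in _).
(* Reduced residues lie in [[0, g)], so the naturals below [g] meet each of them exactly once. *)
suff nuE : (\sum_(0 <= n < g) (n%:Z \in residues H g) = nu g H)%N.
  by rewrite -nuE -[X in (X - _)%N]total addnK.
rewrite -big_mkcond -big_filter big_const_seq count_predT iter_addn_0 mul1n.
rewrite -(size_map Posz); apply: perm_size; apply: uniq_perm.
- by rewrite map_inj_uniq ?filter_uniq ?iota_uniq// => ? ? [].
- exact: fset_uniq.
move=> x; apply/mapP/idP => [[n]|].
  by rewrite mem_filter => /andP[nF _] ->.
move=> xF; have /imfsetP[h /= hH xE] := xF.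
have g0Z : (g%:Z != 0)%Z by rewrite eqz_nat -lt0n.
have x0 : 0 <= x by rewrite xE modz_ge0.
have xg : x < g%:Z by rewrite xE ltz_pmod.
exists `|x|%N; last by rewrite gez0_abs.
by rewrite mem_filter gez0_abs// xF mem_index_iota /= -ltz_nat gez0_abs.
Qed.

Lemma avoids_mod (H : {fset int}) (g n : nat) :
  avoids H g n = avoids H g (n %% g)%N.
Proof. by rewrite /avoids -modz_nat modz_mod. Qed.

(** A period of the conditions up to [z], coprime to every later modulus when [G] is pairwise
    coprime. *)
Fixpoint modulus_upto (G : set nat) (z : nat) : nat :=
  if z is y.+1 then (modulus_upto G y * (if z \in G then z else 1))%N
  else 1%N.

Fixpoint avoids_upto (G : set nat) (H : {fset int}) (z n : nat) : bool :=
  if z is y.+1 then avoids_upto G H y n && ((z \in G) ==> avoids H z n)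
  else true.

Lemma avoids_uptoP (G : set nat) (H : {fset int}) (z n : nat) :
  reflect (forall g, (0 < g <= z)%N -> G g -> avoids H g n)
          (avoids_upto G H z n).
Proof.
apply: (iffP idP).
  elim: z => [|z ih] /=; first by move=> _ [].
  move=> /andP[/ih{}ih /implyP hz] g /andP[g0].
  rewrite leq_eqVlt ltnS => /orP[/eqP -> Gz|gz].
    by apply: hz; rewrite inE.
  by apply: ih; rewrite g0.
elim: z => //= z ih h; rewrite ih ?implybE; last first.
  by move=> g /andP[g0 gz]; apply: h; rewrite g0 leqW.
by case: (boolP (z.+1 \in G)) => //=; rewrite inE => Gz; apply: h => //=.
Qed.

Lemma modulus_upto_gt0 (G : set nat) (z : nat) : (0 < modulus_upto G z)%N.
Proof. by elim: z => //= z ih; rewrite muln_gt0 ih; case: ifP. Qed.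

Lemma coprime_modulus_upto (G : set nat) (z g : nat) :
  pairwise_coprime G -> (z < g)%N -> G g -> coprime (modulus_upto G z) g.
Proof.
move=> G_coprime; elim: z => [|z ih] zg Gg /=; first exact: coprime1n.
rewrite coprimeMl ih//=; last exact: ltnW.
case: ifPn => [|_]; last exact: coprime1n.
by rewrite inE => Gz; apply: G_coprime => // E; rewrite E ltnn in zg.
Qed.

Lemma avoids_upto_mod (G : set nat) (H : {fset int}) (z n : nat) :
  avoids_upto G H z n = avoids_upto G H z (n %% modulus_upto G z)%N.
Proof.
elim: z n => //= z ih n; case: ifPn => zG /=; last by rewrite muln1 !andbT ih.
rewrite ih avoids_mod [in RHS]ih [in X in _ = _ && X]avoids_mod.
by rewrite modn_dvdm ?dvdn_mulr// modn_dvdm ?dvdn_mull.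
Qed.

Lemma density_factor_itv (R : realType) (G : set nat) (H : {fset int})
    (g : nat) :
  admissible G H -> G g ->
  0 <= 1 - (nu g H)%:R / g%:R :> R /\ 1 - (nu g H)%:R / g%:R <= 1 :> R.
Proof.
move=> H_adm Gg; have nug := H_adm _ Gg.
have g0 : 0 < g%:R :> R by rewrite ltr0n (leq_ltn_trans _ nug).
split; last by rewrite gerBl divr_ge0.
by rewrite subr_ge0 ler_pdivrMr// mul1r ler_nat ltnW.
Qed.

Definition partial_density (R : realType) (G : set nat) (H : {fset int})
    (z : nat) : R :=
  \prod_(1 <= g < z.+1 | g \in G) (1 - (nu g H)%:R / g%:R).

Lemma partial_densityS (R : realType) (G : set nat) (H : {fset int}) (z : nat) :
  partial_density R G H z.+1 = partial_density R G H z *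
    (if z.+1 \in G then 1 - (nu z.+1 H)%:R / z.+1%:R else 1).
Proof. by rewrite /partial_density big_mkcond big_nat_recr//= -big_mkcond. Qed.

Lemma partial_density_itv (R : realType) (G : set nat) (H : {fset int})
    (z : nat) :
  admissible G H -> 0 <= partial_density R G H z <= 1.
Proof.
move=> H_adm; elim: z => [|z /andP[ih0 ih1]].
  by rewrite /partial_density big_nil ler01 lexx.
rewrite partial_densityS; case: ifPn => [|_]; last by rewrite mulr1 ih0.
rewrite inE => Gz; have [f0 f1] := density_factor_itv R H_adm Gz.
by rewrite mulr_ge0// mulr_ile1.
Qed.

(** [limn] is meaningful only once convergence is known; monotonicity and the lower bound 0 supply
    it. *)
Lemma cvg_partial_density (R : realType) (G : set nat) (H : {fset int}) :
  admissible G H ->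
  partial_density R G H @ \oo --> sieve_density R G H.
Proof.
move=> H_adm; apply: (@nonincreasing_is_cvgn R (partial_density R G H)).
  apply/nonincreasing_seqP => z; rewrite partial_densityS.
  have /andP[p0 _] := partial_density_itv R z H_adm.
  case: ifPn => [|_]; last by rewrite mulr1.
  rewrite inE => Gz; have [_ f1] := density_factor_itv R H_adm Gz.
  by rewrite ler_piMr.
exists 0 => _ [z _ <-].
by have /andP[] := partial_density_itv R z H_adm.
Qed.

(** A new modulus [g] is coprime to the current period, so it multiplies the count by [g - nu g H],
    that is, the period by [g] and the density by its factor. *)
Lemma sum_avoids_upto (R : realType) (G : set nat) (H : {fset int}) (z : nat) :
  pairwise_coprime G -> admissible G H ->
  (\sum_(0 <= n < modulus_upto G z) avoids_upto G H z n)%N%:R =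
  partial_density R G H z * (modulus_upto G z)%:R.
Proof.
move=> G_coprime H_adm; elim: z => [|z ih].
  by rewrite /partial_density big_nil big_nat1 mul1r.
rewrite partial_densityS /=; case: ifPn => [|_]; last first.
  rewrite mulr1 muln1 -ih; congr _%:R.
  by apply: eq_bigr => n _; rewrite andbT.
rewrite inE => Gz.
have nug := H_adm _ Gz.
rewrite /= sum_coprime_periods//; last first.
- by move=> n; exact: avoids_mod.
- by move=> n; exact: avoids_upto_mod.
- exact: coprime_modulus_upto.
- exact: modulus_upto_gt0.
rewrite natrM ih sum_avoids// natrB; last exact: ltnW.
rewrite natrM -!mulrA; congr (_ * _); rewrite mulrCA; congr (_ * _).
by rewrite mulrBl mul1r mulfVK// pnatr_eq0.
Qed.

Lemma avoids_upto_discrepancy (R : realType) (G : set nat) (H : {fset int})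
    (z N : nat) :
  pairwise_coprime G -> admissible G H ->
  `|(\sum_(0 <= n < N) avoids_upto G H z n)%N%:R
     - partial_density R G H z * N%:R| <= (modulus_upto G z)%:R.
Proof.
move=> G_coprime H_adm; apply: periodic_discrepancy.
- exact: modulus_upto_gt0.
- by move=> n; rewrite avoids_upto_mod modnDr -avoids_upto_mod.
- exact: partial_density_itv.
- exact: sum_avoids_upto.
Qed.

(** * Moduli beyond [z] and the natural density *)

(* A large modulus [N + L <= g] can only remove [n < N] when [n] itself lies
   in [H], so only the moduli below [N + L] contribute beyond level [z]. *)
Lemma sieved_avoids_upto (G : set nat) (H : {fset int}) (z N L n : nat) :
  (forall g, G g -> (0 < g)%N) ->
  (forall h, h \in H -> (`|h| < L)%N) -> (n < N)%N ->
  (avoids_upto G H z n <= (n \in sieved G H) + ((n == 0%N) +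
    \sum_(h <- H) ((n == `|h|%N) + \sum_(z.+1 <= g < N + L | g \in G)
       ((n%:Z == h %[mod g%:Z])%Z : nat))))%N.
Proof.
move=> G_pos HL nN; case: (boolP (avoids_upto G H z n)) => // /avoids_uptoP av.
case: (boolP (n \in sieved G H)) => // nV.
(* Members of [sieved] are positive, so 0 may be lost without any modulus removing it. *)
case: eqVneq => [//|n0].
have [h [g [hH Gg ngh]]] : exists h g,
    [/\ h \in H, G g & (n%:Z = h %[mod g%:Z])%Z].
  apply: contrapT => nex; move/negP : nV; apply; rewrite inE; split.
    by rewrite lt0n.
  by move=> h g hH Gg ngh; apply: nex; exists h, g.
have g0 := G_pos _ Gg.
have zg : (z < g)%N.
  rewrite ltnNge; apply/negP => gz.
  have /avoidsP/(_ h hH) : avoids H g n by apply: av; rewrite ?g0.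
  exact.
rewrite /= !add0n (big_rem h) //=.
have [gNL|NLg] := ltnP g (N + L).
  rewrite (big_rem g) ?mem_index_iota ?zg//=.
  by rewrite ifT ?inE// ngh eqxx !addn_gt0 !orbT.
suff -> : n = `|h|%N by rewrite eqxx.
have hL := HL _ hH.
have /eqP := ngh; rewrite eqz_mod_dvd => /dvdzP[k E].
(* [g] divides [n - h], whose absolute value is below [N + L <= g]. *)
have k0 : k = 0.
  apply/eqP/negPn/negP => k0.
  have : (g <= `|n%:Z - h|)%N.
    by rewrite E abszM absz_nat leq_pmull// absz_gt0.
  have tri (a : nat) (b : int) : (`|a%:Z - b| <= a + `|b|)%N by lia.
  rewrite leqNgt (leq_ltn_trans (tri n h))// (leq_trans _ NLg)//.
  by rewrite -addSn leq_add// ltnW.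
by move: E; rewrite k0 mul0r => /eqP; rewrite subr_eq0 => /eqP <-.
Qed.

Lemma sum_congruent_le (R : realType) (N g : nat) (h : int) : (0 < g)%N ->
  (\sum_(0 <= n < N) ((n%:Z == h %[mod g%:Z])%Z : nat))%N%:R
    <= N%:R / g%:R + 1 :> R.
Proof.
move=> g0.
apply: (@periodic_count_le _ g (fun n => (n%:Z == h %[mod g%:Z])%Z)) => //.
  by move=> n; rewrite PoszD modzDr.
apply: leq_trans (sum_pred1_le1 `|(h %% g%:Z)%Z|%N g).
rewrite big_nat [leqRHS]big_nat; apply: leq_sum => n /andP[_ ng].
have g0Z : (g%:Z != 0)%Z by rewrite eqz_nat -lt0n.
rewrite modz_nat modn_small// -eqz_nat gez0_abs//.
by rewrite modz_ge0.
Qed.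

(** Summing the pointwise bound over [n < N] costs 1 for [n = 0] and, for each [h], 1 for [n = |h|]
    plus the tail over the moduli. *)
Lemma sieved_upto_defect (R : realType) (G : set nat) (H : {fset int})
    (z N L : nat) (t : R) :
  (forall g, G g -> (0 < g)%N) ->
  (forall h, h \in H -> (`|h| < L)%N) ->
  (forall M, \sum_(z.+1 <= g < M | g \in G) g%:R^-1 <= t) ->
  (\sum_(0 <= n < N) avoids_upto G H z n)%N%:R <=
  (\sum_(0 <= n < N) (n \in sieved G H))%N%:R +
    (1 + #|` H|%:R * (1 + (2 * N%:R + L%:R) * t)) :> R.
Proof.
move=> G_pos HL tail.
have : (\sum_(0 <= n < N) avoids_upto G H z n <=
    \sum_(0 <= n < N) (n \in sieved G H) + (1 + \sum_(h <- H) (1 +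
      \sum_(z.+1 <= g < N + L | g \in G)
        \sum_(0 <= n < N) ((n%:Z == h %[mod g%:Z])%Z : nat))))%N.
  apply: (@leq_trans (\sum_(0 <= n < N) ((n \in sieved G H) + ((n == 0%N) +
    \sum_(h <- H) ((n == `|h|%N) + \sum_(z.+1 <= g < N + L | g \in G)
       ((n%:Z == h %[mod g%:Z])%Z : nat))))%N)).
    rewrite big_nat [leqRHS]big_nat; apply: leq_sum => n /andP[_ nN].
    exact: sieved_avoids_upto.
  rewrite big_split big_split /= leq_add2l leq_add//.
    exact: sum_pred1_le1.
  rewrite exchange_big /=; apply: leq_sum => h _.
  rewrite big_split /= leq_add//; first exact: sum_pred1_le1.
  by rewrite exchange_big.
rewrite -(ler_nat R) => /le_trans; apply.
rewrite !natrD lerD2l lerD2l natr_sum.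
rewrite -sum1_size natr_sum mulr_suml.
apply: ler_sum => h _; rewrite mul1r natrD lerD2l natr_sum.
(* A class has at most [N / g + 1] members below [N]; since [g <= N + L], this is at most
   [(2 * N + L) / g]. *)
apply: (@le_trans _ _ (\sum_(z.+1 <= g < N + L | g \in G)
    (2 * N%:R + L%:R) * g%:R^-1)); last first.
  by rewrite -mulr_sumr ler_wpM2l// addr_ge0// mulr_ge0.
rewrite big_nat_cond [leRHS]big_nat_cond.
apply: ler_sum => g /andP[/andP[zg gNL] _].
have g0 : (0 < g)%N by exact: leq_ltn_trans zg.
apply: (le_trans (sum_congruent_le _ _ _ g0)).
have g0R : 0 < g%:R :> R by rewrite ltr0n.
have gR : g%:R <= N%:R + L%:R :> R by rewrite -natrD ler_nat ltnW.
rewrite -(ler_pM2r g0R) mulrDl !mulfVK ?gt_eqF// mul1r.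
lra.
Qed.

(** The level [z] is fixed first, making the tail and the error of the partial product small; then
    [N] grows past the fixed period. *)
Lemma cvg_sieved_density (R : realType) (G : set nat) (H : {fset int})
    (C : R) :
  (forall g, G g -> (0 < g)%N) -> pairwise_coprime G -> admissible G H ->
  (forall N, \sum_(0 <= g < N | g \in G) g%:R^-1 <= C) ->
  (fun n => n%:R^-1 * \sum_(0 <= k < n) \1_(sieved G H) k) @ \oo
    --> sieve_density R G H.
Proof.
move=> G_pos G_coprime H_adm GC.
have [L HL] : exists L, forall h, h \in H -> (`|h| < L)%N.
  exists (\sum_(h <- H) `|h|).+1%N => h hH.
  by rewrite ltnS (big_rem h)//= leq_addr.
pose s N : R := \sum_(0 <= g < N | g \in G) g%:R^-1.
have s_nd : nondecreasing_seq s.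
  apply/nondecreasing_seqP => N; rewrite /s big_mkcond [leRHS]big_mkcond/=.
  by rewrite big_nat_recr//= lerDl; case: ifP.
have s_cvg : cvgn s.
  apply: nondecreasing_is_cvgn => //.
  by exists C => _ [N _ <-]; exact: GC.
have s_le N : s N <= limn s by exact: nondecreasing_cvgn_le.
pose m : R := #|` H|%:R.
have m0 : 0 <= m by [].
apply/cvgrPdist_le => e e0.
(* With this bound on the tail, the part [2 * N * m * e'] of the defect is at most [e / 4 * N]. *)
pose e' : R := e / 8 / (1 + m).
have me' : (1 + m) * e' = e / 8.
  by rewrite mulrC mulfVK// gt_eqF//; lra.
have e'0 : 0 < e' by rewrite !divr_gt0//; lra.
have [z [sz Pz]] : exists z, limn s - e' <= s z.+1 /\
    `|sieve_density R G H - partial_density R G H z| <= e / 4.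
  near (\oo : set_system nat) => z; exists z; split.
    have : limn s - e' <= s z.
      by near: z; apply: (cvgr_ge (limn s)) => //; rewrite gtrBl.
    by move=> /le_trans; apply; exact: s_nd.
  near: z; move: (@cvg_partial_density R _ _ H_adm) => /cvgrPdist_le; apply.
  by rewrite divr_gt0.
have tail M : \sum_(z.+1 <= g < M | g \in G) g%:R^-1 <= e'.
  have [Mz|zM] := leqP M z.+1; first by rewrite big_geq// ltW.
  have := s_le M; rewrite /s (big_cat_nat (n := z.+1))//=; last exact: ltnW.
  by move: sz; rewrite /s; lra.
pose Q : R := (modulus_upto G z)%:R.
(* All error terms that do not grow with [N]. *)
pose K : R := Q + (1 + m * (1 + L%:R * e')).
near=> N.
have N0 : 0 < N%:R :> R by rewrite ltr0n; near: N; exact: nbhs_infty_gt.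
have KN : K <= e / 4 * N%:R.
  rewrite mulrC -ler_pdivrMr ?divr_gt0//; near: N.
  exists (Num.trunc (K / (e / 4))).+1 => //= M /= ?.
  by apply: (le_trans (ltW (truncnS_gt _))); rewrite ler_nat.
have := avoids_upto_discrepancy R z N G_coprime H_adm.
have := sieved_upto_defect N G_pos HL tail.
have : (\sum_(0 <= n < N) (n \in sieved G H))%N%:R <=
    (\sum_(0 <= n < N) avoids_upto G H z n)%N%:R :> R.
  rewrite ler_nat; apply: leq_sum => n _.
  case: (boolP (n \in _)) => //; rewrite inE => -[_ nV].
  rewrite lt0b; apply/avoids_uptoP => g _ Gg; apply/avoidsP => h hH.
  exact: nV.
have -> : \sum_(0 <= k < N) \1_(sieved G H) k =
    (\sum_(0 <= n < N) (n \in sieved G H))%N%:R :> R.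
  by rewrite natr_sum.
set SV := (_%:R : R); set SB := (_%:R : R) => VB BV.
rewrite -/m -/Q ler_norml => /andP[B1 B2].
move: Pz; set c := sieve_density _ _ _; set p := partial_density _ _ _ _.
rewrite ler_norml => /andP[p1 p2].
have me'N : m * e' * N%:R <= e / 8 * N%:R.
  by rewrite ler_wpM2r// -me' ler_wpM2r//; lra.
rewrite -[c](mulfVK (lt0r_neq0 N0)).
have -> : c / N%:R * N%:R - N%:R^-1 * SV = N%:R^-1 * (c * N%:R - SV).
  by rewrite mulrBr [N%:R^-1 * (c * _)]mulrC mulfK ?mulfVK ?gt_eqF.
rewrite normrM gtr0_norm ?invr_gt0// mulrC ler_pdivrMr//.
have cN1 : (c - p) * N%:R <= e / 4 * N%:R by rewrite ler_wpM2r.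
have cN2 : - (e / 4) * N%:R <= (c - p) * N%:R by rewrite ler_wpM2r.
move: KN BV B1 B2; rewrite /K -/p => KN BV B1 B2.
have Le : 0 <= L%:R * e' by rewrite mulr_ge0// ltW.
have mLe : 0 <= m * (L%:R * e') by rewrite mulr_ge0.
rewrite ler_norml; apply/andP; split; lra.
Unshelve. all: by end_near.
Qed.

(** * Convergence of the reciprocal sum from Condition A *)

Lemma sum_mem_le_card (G : set nat) (S : set nat) (N : nat) :
  finite_set S -> (forall g, (g < N)%N -> G g -> S g) ->
  (\sum_(0 <= g < N) (g \in G) <= #|` fset_set S|)%N.
Proof.
move=> finS GS.
rewrite -big_mkcond -big_filter big_const_seq count_predT iter_addn_0 mul1n.
apply: uniq_leq_size; first by rewrite filter_uniq ?iota_uniq.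
move=> g; rewrite mem_filter mem_index_iota => /andP[/set_mem Gg gN].
by rewrite in_fset_set//; apply/mem_set/GS.
Qed.

Lemma ler_exp2_nat (R : realType) (x : R) : exists k0,
  forall k, (k0 <= k)%N -> x <= 2 ^+ k.
Proof.
exists (Num.trunc x).+1 => k xk; apply: (le_trans (ltW (truncnS_gt _))).
by rewrite -natrX ler_nat (leq_trans xk)// ltnW// ltn_expl.
Qed.

Lemma distinct_products_mem (G : set nat) (g : nat) :
  G g -> distinct_products G g.
Proof.
move=> Gg; exists [fset g]%fset; last by rewrite big_seq_fset1.
by move=> x /= /fset1P ->.
Qed.

(** To count up to [y = 2 ^ k], Condition A is used at an index [n] near [y ^ (1 / A0)], where the
    truncation level [n ^ A0] is comparable with [y]. *)
Lemma condition_A_dyadic (R : realType) (G : set nat) (A0 theta : R) :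
  (forall g, G g -> (0 < g)%N) -> 0 < A0 ->
  condition_A theta (@positive_integers R)
    (truncation (distinct_products G) A0) ->
  exists K k0, 0 <= K /\ forall k, (k0 <= k)%N ->
    (\sum_(0 <= g < (2 ^ k).+1) (g \in G))%N%:R <= K * (2 `^ theta) ^+ k.
Proof.
(* The choices are [eps = A0], [A = 1] and [c = 2 ^ (- A0)]; this [c] pays for rounding [t] up to an
   integer [n <= 2 * t]. *)
move=> G_pos A00 [_ /(_ A0 1 (2 `^ A0)^-1 A00 ltr01)].
rewrite invr_gt0 powR_gt0// => /(_ isT)[K [x0 condK]].
have [k1 k1P] := ler_exp2_nat (Num.max x0 1 `^ A0).
have [k2 k2P] := ler_exp2_nat (expR 1 : R).
(* Condition A gives no sign for [K]. Beyond [k1] the index is large enough, and beyond [k2] the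
   logarithm is at least 1. *)
exists (Num.max K 0), (maxn k1 k2); split; first by rewrite le_max lexx orbT.
move=> k; rewrite geq_max => /andP[/k1P x0k /k2P ek].
pose y : R := 2 ^+ k.
have y0 : 0 < y by rewrite exprn_gt0.
pose t := y `^ A0^-1.
have tA : t `^ A0 = y by rewrite -powRrM mulVf ?powRr1 ?gt_eqF// ltW.
have x0t : Num.max x0 1 <= t.
  rewrite leNgt; apply/negP => lt_t.
  have : t `^ A0 < Num.max x0 1 `^ A0.
    by apply: gt0_ltr_powR => //; rewrite nnegrE ?powR_ge0// le_max ler01 orbT.
  by rewrite tA ltNge x0k.
have [x0t' t1] : x0 <= t /\ 1 <= t.
  by move: x0t; rewrite ge_max => /andP.
pose n := (Num.trunc t).+1.
have tn : t <= n%:R by exact/ltW/truncnS_gt.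
have nt : n%:R <= 2 * t.
  have : (Num.trunc t)%:R <= t by rewrite truncn_le// powR_ge0.
  by rewrite /n -natr1; lra.
(* The truncation at [n] keeps every element up to [y]. *)
have yn : y <= n%:R `^ A0.
  by rewrite -tA ge0_ler_powR ?nnegrE ?powR_ge0// ltW.
have ny : (2 `^ A0)^-1 * n%:R `^ A0 <= y.
  rewrite mulrC ler_pdivrMr ?powR_gt0// -tA mulrC -powRM ?powR_ge0//.
  by rewrite ge0_ler_powR ?nnegrE ?mulr_ge0 ?powR_ge0// ltW.
have := condK n%:R y _ (le_trans x0t' tn) ny.
move=> /(_ _)/le_trans => bound.
apply: (@le_trans _ _ (#|` fset_set (truncation (distinct_products G) A0 n%:R
    `&` [set a | (1 <= a)%N /\ a%:R <= y])|%:R)).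
  rewrite ler_nat; apply: sum_mem_le_card.
    apply: (@sub_finite_set _ _ `I_(2 ^ k).+1); last exact: finite_II.
    by move=> a /= [_ [_]]; rewrite /y -natrX ler_nat.
  move=> g; rewrite ltnS => gk Gg.
  have gy : g%:R <= y by rewrite /y -natrX ler_nat.
  split; last by split => //; exact: G_pos.
  by split; [exact: distinct_products_mem|exact: le_trans yn].
apply: bound; first by exists n.
have -> : (2 `^ theta) ^+ k = y `^ theta :> R.
  by rewrite /y -!powR_mulrn ?powR_ge0// -!powRrM mulrC.
have ln1 : 1 <= ln y by rewrite -[1]expRK ler_ln ?posrE// expR_gt0.
have lny : 0 <= ln y `^ (- 1) <= 1.
  rewrite powR_ge0 powR_inv1 ?invf_le1//; lra.
have yt : 0 <= y `^ theta by exact: powR_ge0.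
apply: (@le_trans _ _ (Num.max K 0 * (y `^ theta * ln y `^ (- 1)))).
  apply: ler_wpM2r; first by rewrite mulr_ge0//; case/andP: lny.
  by rewrite le_max lexx.
apply: ler_wpM2l; first by rewrite le_max lexx orbT.
by rewrite ler_piMr//; case/andP: lny.
Qed.

(** The block from [2 ^ k] to [2 ^ k.+1] adds at most [K * (2 * q) ^ k.+1 / 2 ^ k = 2 * K * q ^
    k.+1], a geometric term. *)
Lemma sum_inv_dyadic_bounded (R : realType) (G : set nat) (K q : R)
    (k0 : nat) :
  0 <= K -> 0 < q < 1 ->
  (forall k, (k0 <= k)%N ->
    (\sum_(0 <= g < (2 ^ k).+1) (g \in G))%N%:R <= K * (2 * q) ^+ k) ->
  exists C : R, forall N, \sum_(0 <= g < N | g \in G) g%:R^-1 <= C.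
Proof.
move=> K0 /andP[q0 q1] cnt.
pose s N : R := \sum_(0 <= g < N | g \in G) g%:R^-1.
have s_le M N : (M <= N)%N -> s M <= s N.
  move=> MN; rewrite /s [leRHS](big_cat_nat (n := M))//= lerDl.
  by apply: sumr_ge0.
(* [D * q ^ k] is the geometric tail from [k] on, so [s (2 ^ k) + D * q ^ k] does not increase for
   [k >= k0]. *)
pose D := 2 * K * q / (1 - q).
have DE : 2 * K * q = D * (1 - q) by rewrite mulfVK//; lra.
have D0 : 0 <= D by rewrite divr_ge0 ?mulr_ge0//; lra.
have step k : (k0 <= k)%N -> s (2 ^ k.+1)%N <= s (2 ^ k)%N + 2 * K * q ^+ k.+1.
  move=> kk; have kk1 : (2 ^ k <= 2 ^ k.+1)%N by rewrite leq_exp2l.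
  rewrite /s (big_cat_nat (n := (2 ^ k)%N))//= lerD2l.
  apply: (@le_trans _ _ (\sum_(0 <= g < (2 ^ k.+1).+1)
      (g \in G)%:R * (2 ^+ k)^-1)); last first.
    rewrite -mulr_suml -natr_sum ler_pdivrMr ?exprn_gt0//.
    apply: (le_trans (cnt _ (leqW kk))).
    by rewrite exprMn [_ ^+ k.+1]exprS; nra.
  rewrite [leRHS](big_cat_nat (n := (2 ^ k)%N)) ?leqW//=.
  rewrite [X in _ <= _ + X](big_cat_nat (n := (2 ^ k.+1)%N))//=.
  rewrite -[leLHS]add0r lerD//; first by apply: sumr_ge0 => *; rewrite mulr_ge0.
  rewrite -[leLHS]addr0 lerD//; last first.
    by apply: sumr_ge0 => *; rewrite mulr_ge0.
  rewrite big_mkcond big_nat [leRHS]big_nat.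
  apply: ler_sum => g /andP[kg _]; case: ifPn => gG; last by rewrite mul0r.
  have k20 : 0 < (2 ^+ k : R) by rewrite exprn_gt0.
  have kgR : 2 ^+ k <= g%:R :> R by rewrite -natrX ler_nat.
  by rewrite mul1r lef_pV2 ?posrE// (lt_le_trans k20).
have bound k : s (2 ^ (k0 + k))%N + D * q ^+ (k0 + k) <=
    s (2 ^ k0)%N + D * q ^+ k0.
  elim: k => [|k ih]; first by rewrite addn0.
  rewrite addnS; apply: le_trans ih.
  have := step _ (leq_addr k k0); rewrite exprS.
  have -> : 2 * K * (q * q ^+ (k0 + k)) = D * (1 - q) * q ^+ (k0 + k).
    by rewrite -DE !mulrA.
  lra.
exists (s (2 ^ k0)%N + D * q ^+ k0) => N.
apply: le_trans (bound N); rewrite -[leLHS]addr0; apply: lerD.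
  apply: s_le; apply: (@leq_trans (k0 + N)); first exact: leq_addl.
  by rewrite ltnW// ltn_expl.
by rewrite mulr_ge0// exprn_ge0// ltW.
Qed.

(** * The almost sure limit *)

Lemma centered_sum_average_ae d (T : measurableType d) (R : realType)
    (P : probability T R) (W : nat -> {RV P >-> nat}) (alpha : R)
    (f : nat -> R) :
  mutually_independent W -> (forall i, is_bernoulli alpha (W i)) ->
  0 <= alpha <= 1 -> (forall k, `|f k| <= 1) ->
  {ae P, forall w, (forall i, (W i w <= 1)%N) ->
    (fun n => n%:R^-1 * \sum_(0 <= i < n)
       f (walk W i w) * ((W i w)%:R - alpha)) @ \oo --> (0 : R)}.
Proof.
move=> W_indep W_bern a01 f1.
apply: filterS (centered_sum_quartic_ae W_indep W_bern a01 f1) => w small W1.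
under eq_fun do rewrite -centered_sum_history//.
apply: cvg0_of_quartic => // n; rewrite /= addrC addKr normrM.
rewrite mulr_ile1//; case/andP: a01 => a0 a1.
by rewrite ler_norml; case: (_ == _) => /=; lra.
Qed.

Theorem theorem1p5 (R : realType) (G : set nat) (H : {fset int})
    (G_pos : forall g, G g -> (0 < g)%N)
    (G_coprime : pairwise_coprime G)
    (H_adm : admissible G H)
    (A0 : R) (A0_gt0 : 0 < A0)
    (theta : R) (theta_gt0 : 0 < theta) (theta_lt1 : theta < 1)
    (condA : condition_A theta (@positive_integers R)
               (truncation (distinct_products G) A0))
    (alpha : R) (alpha_gt0 : 0 < alpha) (alpha_lt1 : alpha < 1)
    (d : measure_display) (T : measurableType d) (P : probability T R)
    (W : nat -> {RV P >-> nat})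
    (W_indep : mutually_independent W)
    (W_bern : forall i, is_bernoulli alpha (W i)) :
  {ae P, forall w,
    (fun n => walk_average R W (sieved G H) n w) @ \oo
      --> sieve_density R G H}.
Proof.
have [K [k0 [K0 dyadic]]] := condition_A_dyadic G_pos A0_gt0 condA.
(* Here [theta < 1] makes the dyadic ratio [2 ^ (theta - 1)] less than 1. *)
have q01 : 0 < 2 `^ theta / 2 < (1 : R).
  rewrite divr_gt0 ?powR_gt0//= ltr_pdivrMr// mul1r.
  have ln2 : 0 < ln (2 : R) by rewrite ln_gt0// ltr1n.
  rewrite /powR pnatr_eq0 /= -[X in _ < X](@lnK R 2) ?posrE//.
  by rewrite ltr_expR gtr_pMl.
have [C GC] : exists C : R, forall N, \sum_(0 <= g < N | g \in G) g%:R^-1 <= C.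
  apply: (sum_inv_dyadic_bounded (k0 := k0) K0 q01) => k kk.
  by rewrite [2 * _]mulrC divfK ?pnatr_eq0//; exact: dyadic.
have Vc := cvg_sieved_density G_pos G_coprime H_adm GC.
have V1 k : `|\1_(sieved G H) k : R| <= 1.
  by rewrite indicE; case: (_ \in _); rewrite ?normr1 ?normr0.
have a01 : 0 <= alpha <= 1 by rewrite !ltW.
have one1 (k : nat) : `|1 : R| <= 1 by rewrite normr1.
have ae1 := steps_le1_ae W_bern.
have aeV := centered_sum_average_ae W_indep W_bern a01 V1.
have aeW := centered_sum_average_ae W_indep W_bern a01 one1.
apply: filterS3 ae1 aeV aeW => w W1 /(_ W1) LV /(_ W1) LW.
apply: cvg_walk_average (alpha_gt0) V1 W1 Vc _ LV.
(* The constant weight 1 gives the deviation of the steps themselves, hence the speed of the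
   walk. *)
by under eq_fun do under eq_bigr do rewrite -[_ - _]mul1r.
Qed.
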